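(* Let $S$ be the unilateral shift on $\mathcal{H}=\ell^2(\mathbb{N})$ with canonical basis $\{e_1,e_2,\dots\}$. Let $\lambda=(\lambda_1,\lambda_2,\dots)\in\ell^\infty(\mathbb{N})$ with $\lambda_i\neq\lambda_j$ whenever $i\neq j$, and let $D_\lambda=\mathrm{diag}(\lambda_1,\lambda_2,\dots)$ be the associated diagonal operator. Take a vector $\overline{w}=(\overline{w_n})_n\in\ell^2(\mathbb{N})$ such that $w_n\neq 0$ for all $n\in\mathbb{N}$. Put $$A=SD_\lambda+\theta_{e_1,\overline{w}}\quad\text{and}\quad B=S.$$ Then $\ker A=0$ and the quotient $BA^{-1}$ is a transitive operator. Furthermore, the operator $BA^{-1}$ is densely defined if and only if $\lambda_k\neq 0$ for each $k\in\mathbb{N}$ and $\left(\frac{w_k}{\lambda_k}\right)_k\notin\ell^2(\mathbb{N})$.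
   Context: Hilbert spaces are complex with inner product $(\cdot\,|\,\cdot)$ linear in the first variable; $\mathbb{N}=\{1,2,\dots\}$; $Se_n=e_{n+1}$. For vectors $x,y$, $\theta_{x,y}$ is the rank one operator $\theta_{x,y}(z)=(z\,|\,y)x$; so $\theta_{e_1,\overline{w}}(x)=(\sum_n x_nw_n)e_1$. For $A,B\in B(\mathcal{H})$ the quotient $BA^{-1}$ denotes $B(A|_{(\ker A)^\perp})^{-1}$; when $\ker A=0$ it is the linear operator with domain $\mathrm{Im}\,A$ given by $Ax\mapsto Bx$, $x\in\mathcal{H}$. An ''unbounded closed operator'' $C$ on $\mathcal{H}$ means a closed linear operator with domain a linear subspace $D(C)\subset\mathcal{H}$ (not necessarily bounded, not necessarily densely defined). Its (bounded) commutant is $\{C\}'=\{R\in B(\mathcal{H}): R(D(C))\subset D(C)\text{ and }CRx=RCx\text{ for all }x\in D(C)\}$. A transitive operator is a closed operator $C$ in this sense such that every element of $\{C\}'$ is a scalar operator. *)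

(* Defs.v *)
From Stdlib Require Import Reals Lra Lia FunctionalExtensionality ProofIrrelevance.
From Coquelicot Require Import Coquelicot.

Open Scope R_scope.

Local Ltac c_ring :=
  simpl; lazymatch goal with |- @eq _ ?a ?b => change (@eq C a b) end;
  unfold mult, plus, opp, one, zero; simpl; ring.

(** * Bounded and unbounded operators on a complex normed space *)

(* Coquelicot's [is_linear] includes boundedness. *)
Record bounded_op (H : NormedModule C_AbsRing) := Bounded_op {
  bop_fun :> H -> H;
  bop_linear : is_linear bop_fun
}.

(* A linear operator, defined on a linear subspace, is given by its graph. *)
Record operator (H : NormedModule C_AbsRing) := Operator {
  graph :> H -> H -> Prop;
  graph_fun : forall x y y', graph x y -> graph x y' -> y = y';
  graph_zero : graph zero zero;
  graph_plus : forall x y x' y', graph x y -> graph x' y' ->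
    graph (plus x x') (plus y y');
  graph_scal : forall (c : C) x y, graph x y -> graph (scal c x) (scal c y)
}.

Arguments Bounded_op {H}.
Arguments bop_fun {H}.
Arguments bop_linear {H}.
Arguments Operator {H}.
Arguments graph {H}.

Section Operators.

Context {H : NormedModule C_AbsRing}.

Definition bop_comp (A B : bounded_op H) : bounded_op H :=
  Bounded_op (fun x => A (B x))
    (is_linear_comp B A (bop_linear B) (bop_linear A)).

Definition bop_plus (A B : bounded_op H) : bounded_op H :=
  Bounded_op (fun x => plus (A x) (B x))
    (is_linear_comp (fun x => (A x, B x)) (fun p => plus (fst p) (snd p))
      (is_linear_prod A B (bop_linear A) (bop_linear B)) is_linear_plus).

Definition ker (A : bounded_op H) (x : H) : Prop := A x = zero.

Definition scalar_op (A : bounded_op H) : Prop :=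
  exists c : C, forall x : H, A x = scal c x.

Definition dom (T : operator H) (x : H) : Prop := exists y, T x y.

Definition closed_op (T : operator H) : Prop :=
  closed (fun p : H * H => T (fst p) (snd p)).

Definition densely_defined (T : operator H) : Prop :=
  forall (x : H) (eps : posreal), exists y, dom T y /\ ball x eps y.

(* The second condition is T R x = R T x for x in the domain of T. *)
Definition in_commutant (T : operator H) (R : bounded_op H) : Prop :=
  (forall x, dom T x -> dom T (R x)) /\
  (forall x y z, T x y -> T (R x) z -> z = R y).

Definition transitive_op (T : operator H) : Prop :=
  closed_op T /\ forall R : bounded_op H, in_commutant T R -> scalar_op R.

End Operators.

(** * The Hilbert space l^2, with coordinates indexed from 0 *)

Definition in_l2 (u : nat -> C) : Prop := ex_series (fun n => Cmod (u n) ^ 2).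

Record l2 := L2 { l2_seq :> nat -> C; l2_prop : in_l2 l2_seq }.

Lemma l2_eq (x y : l2) : (forall n, x n = y n) -> x = y.
Proof.
destruct x as [x hx], y as [y hy]; simpl; intros h.
assert (e : x = y) by (apply functional_extensionality; exact h).
subst y; f_equal; apply proof_irrelevance.
Qed.

Lemma ex_series_le_pos (a b : nat -> R) :
  (forall n, 0 <= a n <= b n) -> ex_series b -> ex_series a.
Proof.
intros h hb; apply (ex_series_le (K := R_AbsRing) (V := R_CompleteNormedModule) a b);
  trivial.
intros n; change (Rabs (a n) <= b n); rewrite Rabs_pos_eq; apply h.
Qed.

Lemma in_l2_plus (u v : nat -> C) :
  in_l2 u -> in_l2 v -> in_l2 (fun n => Cplus (u n) (v n)).
Proof.
intros hu hv; unfold in_l2.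
apply (ex_series_le_pos _ (fun n => 2 * Cmod (u n) ^ 2 + 2 * Cmod (v n) ^ 2)).
- intros n; split; [apply pow2_ge_0|].
  assert (h := Cmod_triangle (u n) (v n)).
  assert (h0 := Cmod_ge_0 (u n + v n)).
  assert (h1 := pow2_ge_0 (Cmod (u n) - Cmod (v n))).
  nra.
- apply (ex_series_plus (V := R_NormedModule)
    (fun n => 2 * Cmod (u n) ^ 2) (fun n => 2 * Cmod (v n) ^ 2));
  [apply (ex_series_scal_l 2 (fun n => Cmod (u n) ^ 2) hu)
  |apply (ex_series_scal_l 2 (fun n => Cmod (v n) ^ 2) hv)].
Qed.

Lemma in_l2_mult_bounded (u v : nat -> C) (M : R) :
  (forall n, Cmod (u n) <= M) -> in_l2 v -> in_l2 (fun n => Cmult (u n) (v n)).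
Proof.
intros hu hv; unfold in_l2.
apply (ex_series_le_pos _ (fun n => M ^ 2 * Cmod (v n) ^ 2)).
- intros n; split; [apply pow2_ge_0|].
  rewrite Cmod_mult, Rpow_mult_distr.
  apply Rmult_le_compat_r; [apply pow2_ge_0|].
  apply pow_incr; split; [apply Cmod_ge_0|apply hu].
- apply (ex_series_scal_l (M ^ 2) (fun n => Cmod (v n) ^ 2) hv).
Qed.

Lemma in_l2_0 : in_l2 (fun _ => 0%C).
Proof.
exists 0; apply (is_series_ext (fun _ => 0)).
- intros n; rewrite Cmod_0, pow_ne_zero; trivial; discriminate.
- apply (filterlim_ext (fun _ => 0)); [|apply filterlim_const].
  intros n; rewrite sum_n_const; ring.
Qed.

Definition l2_zero : l2 := L2 _ in_l2_0.

Definition l2_plus (x y : l2) : l2 := L2 _ (in_l2_plus x y (l2_prop x) (l2_prop y)).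

Definition l2_scal (c : C) (x : l2) : l2 :=
  L2 _ (in_l2_mult_bounded (fun _ => c) x (Cmod c) (fun _ => Rle_refl _) (l2_prop x)).

Definition l2_opp (x : l2) : l2 := l2_scal (Copp 1%C) x.

Definition l2_norm (x : l2) : R := sqrt (Series (fun n => Cmod (x n) ^ 2)).

Lemma Series_pos (a : nat -> R) : (forall n, 0 <= a n) -> ex_series a -> 0 <= Series a.
Proof.
intros h ha; rewrite <- (Rmult_0_l (Series (fun n => a n))), <- Series_scal_l.
apply Series_le; trivial; intros n; specialize (h n); lra.
Qed.

Lemma l2_norm_ge0 x : 0 <= l2_norm x.
Proof. apply sqrt_pos. Qed.

Lemma l2_norm_sqr (x : l2) : l2_norm x ^ 2 = Series (fun n => Cmod (x n) ^ 2).
Proof.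
unfold l2_norm; rewrite pow2_sqrt; trivial.
apply Series_pos; [intros n; apply pow2_ge_0|apply l2_prop].
Qed.

Lemma ex_series_l2_prod (x y : l2) : ex_series (fun n => Cmod (x n) * Cmod (y n)).
Proof.
apply (ex_series_le_pos _ (fun n => Cmod (x n) ^ 2 + Cmod (y n) ^ 2)).
- intros n; assert (h := Cmod_ge_0 (x n)); assert (h' := Cmod_ge_0 (y n)).
  split; [nra|].
  assert (h1 := pow2_ge_0 (Cmod (x n) - Cmod (y n))); nra.
- apply (ex_series_plus (V := R_NormedModule)
    (fun n => Cmod (x n) ^ 2) (fun n => Cmod (y n) ^ 2)); apply l2_prop.
Qed.

Lemma l2_Cauchy_Schwarz (x y : l2) :
  Series (fun n => Cmod (x n) * Cmod (y n)) <= l2_norm x * l2_norm y.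
Proof.
set (P := Series _).
assert (hx := l2_norm_ge0 x); assert (hy := l2_norm_ge0 y).
assert (hP := ex_series_l2_prod x y).
assert (key : forall s t, 0 <= s ^ 2 * l2_norm x ^ 2 - 2 * (s * t) * P + t ^ 2 * l2_norm y ^ 2).
{ intros s t; rewrite !l2_norm_sqr; unfold P.
  rewrite <- !Series_scal_l.
  assert (e1 := ex_series_scal_l (s ^ 2) _ (l2_prop x)).
  assert (e2 := ex_series_scal_l (t ^ 2) _ (l2_prop y)).
  assert (e3 := ex_series_scal_l (2 * (s * t)) _ hP).
  rewrite <- Series_minus; trivial.
  rewrite <- Series_plus; trivial;
    [|exact (ex_series_minus (V := R_NormedModule) _ _ e1 e3)].
  apply Series_pos.
  - intros n; assert (h := pow2_ge_0 (s * Cmod (x n) - t * Cmod (y n))).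
    simpl in *; nra.
  - apply (ex_series_plus (V := R_NormedModule)); trivial.
    exact (ex_series_minus (V := R_NormedModule) _ _ e1 e3). }
assert (hP0 : 0 <= P).
{ apply Series_pos; trivial; intros n.
  apply Rmult_le_pos; apply Cmod_ge_0. }
assert (kP : P ^ 2 <= (l2_norm x * l2_norm y) ^ 2).
{ destruct (Req_dec (l2_norm y) 0) as [e|ne].
  - assert (h := key P (1 + l2_norm x ^ 2)); rewrite e in *.
    assert (h1 := pow2_ge_0 P); assert (h2 := pow2_ge_0 (l2_norm x)).
    nra.
  - assert (h := key (l2_norm y ^ 2) P).
    assert (hp : 0 < l2_norm y ^ 2) by (apply pow_lt; lra).
    apply (Rmult_le_reg_l (l2_norm y ^ 2)); trivial; nra. }
apply Rsqr_incr_0_var; [unfold Rsqr; nra|apply Rmult_le_pos; trivial].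
Qed.

Lemma l2_norm_triangle x y : l2_norm (l2_plus x y) <= l2_norm x + l2_norm y.
Proof.
assert (hx := l2_norm_ge0 x); assert (hy := l2_norm_ge0 y).
apply Rsqr_incr_0_var; [|lra].
rewrite !Rsqr_pow2, l2_norm_sqr; simpl l2_seq.
assert (hP := ex_series_l2_prod x y).
assert (e3 := ex_series_scal_l 2 _ hP).
assert (e12 := ex_series_plus (V := R_NormedModule) _ _ (l2_prop x) (l2_prop y)).
apply (Rle_trans _ (Series (fun n => (Cmod (x n) ^ 2 + Cmod (y n) ^ 2)
   + 2 * (Cmod (x n) * Cmod (y n))))).
- apply Series_le.
  + intros n; split; [apply pow2_ge_0|].
    assert (h := Cmod_triangle (x n) (y n)).
    assert (h0 := Cmod_ge_0 (x n + y n)); nra.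
  + exact (ex_series_plus (V := R_NormedModule) _ _ e12 e3).
- rewrite Series_plus; trivial; rewrite Series_plus; try apply l2_prop.
  rewrite Series_scal_l, <- !l2_norm_sqr.
  assert (h := l2_Cauchy_Schwarz x y); nra.
Qed.

Lemma l2_norm_scal c x : l2_norm (l2_scal c x) = Cmod c * l2_norm x.
Proof.
unfold l2_norm at 1; simpl l2_seq.
rewrite (Series_ext _ (fun n => Cmod c ^ 2 * Cmod (x n) ^ 2)).
- rewrite Series_scal_l, sqrt_mult_alt, sqrt_pow2; trivial;
    [apply Cmod_ge_0|apply pow2_ge_0].
- intros n; rewrite Cmod_mult; ring.
Qed.

Lemma l2_coord_le_norm (x : l2) n : Cmod (x n) <= l2_norm x.
Proof.
apply Rsqr_incr_0_var; [|apply l2_norm_ge0].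
rewrite !Rsqr_pow2, l2_norm_sqr.
apply (Rle_trans _ (sum_f_R0 (fun k => Cmod (x k) ^ 2) n)).
- destruct n; simpl; [lra|].
  assert (h : 0 <= sum_f_R0 (fun k => Cmod (x k) * (Cmod (x k) * 1)) n); [|lra].
  apply cond_pos_sum; intros k; apply (pow2_ge_0 (Cmod (x k))).
- rewrite <- sum_n_Reals.
  apply (is_lim_seq_incr_compare (sum_n (fun k => Cmod (x k) ^ 2))).
  + exact (Series_correct _ (l2_prop x)).
  + intros m; rewrite sum_Sn; unfold plus; simpl.
    assert (h := pow2_ge_0 (Cmod (x (S m)))); simpl in h; lra.
Qed.

Lemma l2_norm_eq0 x : l2_norm x = 0 -> x = l2_zero.
Proof.
intros h; apply l2_eq; intros n; simpl.
apply Cmod_eq_0; apply Rle_antisym; [|apply Cmod_ge_0].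
rewrite <- h; apply l2_coord_le_norm.
Qed.

Definition l2_AbelianMonoid_mixin : AbelianMonoid.mixin_of l2.
Proof.
apply (AbelianMonoid.Mixin l2 l2_plus l2_zero); intros; apply l2_eq; intros n; c_ring.
Defined.

Canonical l2_AbelianMonoid := AbelianMonoid.Pack l2 l2_AbelianMonoid_mixin l2.

Definition l2_AbelianGroup_mixin : AbelianGroup.mixin_of l2_AbelianMonoid.
Proof.
apply (AbelianGroup.Mixin l2_AbelianMonoid l2_opp).
intros x; apply l2_eq; intros n; c_ring.
Defined.

Canonical l2_AbelianGroup := AbelianGroup.Pack l2
  (AbelianGroup.Class l2 l2_AbelianMonoid_mixin l2_AbelianGroup_mixin) l2.

Definition l2_ModuleSpace_mixin : ModuleSpace.mixin_of C_Ring l2_AbelianGroup.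
Proof.
apply (ModuleSpace.Mixin C_Ring l2_AbelianGroup l2_scal);
  intros; apply l2_eq; intros n; c_ring.
Defined.

Canonical l2_ModuleSpace := ModuleSpace.Pack C_Ring l2
  (ModuleSpace.Class C_Ring l2 (AbelianGroup.class l2_AbelianGroup)
    l2_ModuleSpace_mixin) l2.

Definition l2_ball (x : l2) (eps : R) (y : l2) : Prop := l2_norm (minus y x) < eps.

Definition l2_UniformSpace_mixin : UniformSpace.mixin_of l2.
Proof.
apply (UniformSpace.Mixin l2 l2_zero l2_ball).
- intros x e; unfold l2_ball; rewrite minus_eq_zero.
  change (l2_norm l2_zero < e).
  replace l2_zero with (l2_scal 0 l2_zero) by (apply l2_eq; intros; c_ring).
  rewrite l2_norm_scal, Cmod_0, Rmult_0_l; apply cond_pos.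
- intros x y e; unfold l2_ball.
  replace (minus x y) with (l2_scal (Copp 1%C) (minus y x))
    by (apply l2_eq; intros; c_ring).
  rewrite l2_norm_scal, Cmod_opp, Cmod_1, Rmult_1_l; trivial.
- intros x y z e1 e2; unfold l2_ball; intros h1 h2.
  replace (minus z x) with (l2_plus (minus z y) (minus y x))
    by (apply l2_eq; intros; c_ring).
  assert (h := l2_norm_triangle (minus z y) (minus y x)); lra.
Defined.

Canonical l2_UniformSpace := UniformSpace.Pack l2 l2_UniformSpace_mixin l2.

Canonical l2_NormedModuleAux := NormedModuleAux.Pack C_AbsRing l2
  (NormedModuleAux.Class C_AbsRing l2 (ModuleSpace.class C_Ring l2_ModuleSpace)
    l2_UniformSpace_mixin) l2.

Definition l2_NormedModule_mixin : NormedModule.mixin_of C_AbsRing l2_NormedModuleAux.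
Proof.
apply (NormedModule.Mixin C_AbsRing l2_NormedModuleAux l2_norm 1).
- exact l2_norm_triangle.
- intros c x; apply Req_le, l2_norm_scal.
- intros x y eps h; exact h.
- intros x y eps h; rewrite Rmult_1_l; exact h.
- exact l2_norm_eq0.
Defined.

Canonical l2_NormedModule := NormedModule.Pack C_AbsRing l2
  (NormedModule.Class C_AbsRing l2 (NormedModuleAux.class C_AbsRing l2_NormedModuleAux)
    l2_NormedModule_mixin) l2.

(* Coquelicot's [Series] is real-valued, so the sum of the x_n conj(y_n) is
   taken componentwise; see [inner_is_series]. *)
Definition inner (x y : l2) : C :=
  (Series (fun n => Re (x n * Cconj (y n))), Series (fun n => Im (x n * Cconj (y n)))).

Lemma Cmod_mult_conj (a b : C) : Cmod (a * Cconj b) = Cmod a * Cmod b.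
Proof. rewrite Cmod_mult, Cmod_conj; trivial. Qed.

Lemma Im_le_Cmod (c : C) : Rabs (Im c) <= Cmod c.
Proof.
apply (Rle_trans _ (Rmax (Rabs (fst c)) (Rabs (snd c)))); [apply Rmax_r|apply Rmax_Cmod].
Qed.

Lemma ex_series_inner_abs_re (x y : l2) : ex_series (fun n => Rabs (Re (x n * Cconj (y n)))).
Proof.
apply (ex_series_le_pos _ _) with (2 := ex_series_l2_prod x y); intros n.
split; [apply Rabs_pos|rewrite <- Cmod_mult_conj; apply re_le_Cmod].
Qed.

Lemma ex_series_inner_abs_im (x y : l2) : ex_series (fun n => Rabs (Im (x n * Cconj (y n)))).
Proof.
apply (ex_series_le_pos _ _) with (2 := ex_series_l2_prod x y); intros n.
split; [apply Rabs_pos|rewrite <- Cmod_mult_conj; apply Im_le_Cmod].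
Qed.

Lemma ex_series_inner_re (x y : l2) : ex_series (fun n => Re (x n * Cconj (y n))).
Proof. exact (ex_series_Rabs _ (ex_series_inner_abs_re x y)). Qed.

Lemma ex_series_inner_im (x y : l2) : ex_series (fun n => Im (x n * Cconj (y n))).
Proof. exact (ex_series_Rabs _ (ex_series_inner_abs_im x y)). Qed.

Lemma sum_n_C (u : nat -> C) n :
  sum_n u n = (sum_n (fun k => Re (u k)) n, sum_n (fun k => Im (u k)) n).
Proof.
induction n as [|n IH].
- rewrite !sum_O; apply surjective_pairing.
- rewrite !sum_Sn, IH; reflexivity.
Qed.

Lemma inner_is_series (x y : l2) :
  is_series (fun n => (x n * Cconj (y n))%C : C_NormedModule) (inner x y).
Proof.
unfold is_series.
apply (filterlim_ext (fun n => (sum_n (fun k => Re (x k * Cconj (y k))) n,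
   sum_n (fun k => Im (x k * Cconj (y k))) n))).
- intros n; symmetry; apply sum_n_C.
- assert (h1 := Series_correct _ (ex_series_inner_re x y)).
  assert (h2 := Series_correct _ (ex_series_inner_im x y)).
  apply (filterlim_locally (U := C_UniformSpace)); intros eps.
  assert (h1' := proj1 (filterlim_locally (U := R_UniformSpace) _ _) h1 eps).
  assert (h2' := proj1 (filterlim_locally (U := R_UniformSpace) _ _) h2 eps).
  generalize (filter_and _ _ h1' h2'); apply filter_imp.
  intros n [a b]; split; assumption.
Qed.

Lemma inner_self (x : l2) : inner x x = RtoC (norm x ^ 2).
Proof.
change (norm x) with (l2_norm x); rewrite l2_norm_sqr.
unfold inner, RtoC; f_equal.
- apply Series_ext; intros n; unfold Cmod.
  rewrite pow2_sqrt by nra; simpl; ring.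
- rewrite <- (Rmult_0_l (Series (fun _ => 0))), <- Series_scal_l.
  apply Series_ext; intros n; simpl; ring.
Qed.

Lemma inner_plus_l x y z : inner (plus x y) z = Cplus (inner x z) (inner y z).
Proof.
unfold inner, Cplus; simpl fst; simpl snd; f_equal;
  rewrite <- Series_plus; try apply ex_series_inner_re; try apply ex_series_inner_im;
  apply Series_ext; intros n; simpl; ring.
Qed.

Lemma inner_scal_l c x y : inner (scal c x) y = Cmult c (inner x y).
Proof.
assert (hr := ex_series_inner_re x y); assert (hi := ex_series_inner_im x y).
unfold inner, Cmult at 3; simpl fst; simpl snd.
rewrite <- !Series_scal_l.
rewrite <- Series_minus, <- Series_plus;
  try (apply (ex_series_scal_l (V := R_NormedModule)); assumption).
f_equal; apply Series_ext; intros n; simpl; ring.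
Qed.

Lemma inner_bound x y : Cmod (inner x y) <= 2 * (l2_norm x * l2_norm y).
Proof.
assert (h := l2_Cauchy_Schwarz x y).
assert (hp := ex_series_l2_prod x y).
assert (h1 : Rabs (fst (inner x y)) <= l2_norm x * l2_norm y).
{ apply (Rle_trans _ _ _ (Series_Rabs _ (ex_series_inner_abs_re x y))).
  apply (Rle_trans _ _ _) with (2 := h); apply Series_le; trivial; intros n.
  split; [apply Rabs_pos|rewrite <- Cmod_mult_conj; apply re_le_Cmod]. }
assert (h2 : Rabs (snd (inner x y)) <= l2_norm x * l2_norm y).
{ apply (Rle_trans _ _ _ (Series_Rabs _ (ex_series_inner_abs_im x y))).
  apply (Rle_trans _ _ _) with (2 := h); apply Series_le; trivial; intros n.
  split; [apply Rabs_pos|rewrite <- Cmod_mult_conj; apply Im_le_Cmod]. }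
apply (Rle_trans _ _ _ (Cmod_2Rmax _)).
assert (hm : Rmax (Rabs (fst (inner x y))) (Rabs (snd (inner x y)))
   <= l2_norm x * l2_norm y) by (apply Rmax_lub; trivial).
assert (hs : sqrt 2 <= 2).
{ rewrite <- (sqrt_square 2) at 2 by lra; apply sqrt_le_1_alt; lra. }
apply Rmult_le_compat; trivial; [apply sqrt_pos|].
apply (Rle_trans _ _ _ (Rabs_pos _) (Rmax_l _ _)).
Qed.

(** * Shift, diagonal, rank one and quotient operators *)

Definition shift_seq (u : nat -> C) (n : nat) : C :=
  match n with O => 0%C | S m => u m end.

Lemma is_series_shift_seq (u : nat -> C) (l : R) :
  is_series (fun n => Cmod (u n) ^ 2) l ->
  is_series (fun n => Cmod (shift_seq u n) ^ 2) l.
Proof.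
intros h; apply is_series_decr_1.
replace (plus l _) with l; [exact h|].
simpl; rewrite Cmod_0; unfold plus, opp; simpl; ring.
Qed.

Lemma in_l2_shift u : in_l2 u -> in_l2 (shift_seq u).
Proof. intros [l h]; exists l; apply is_series_shift_seq; exact h. Qed.

Definition shift_fun (x : l2) : l2 := L2 _ (in_l2_shift x (l2_prop x)).

Lemma shift_norm x : l2_norm (shift_fun x) = l2_norm x.
Proof.
unfold l2_norm; f_equal; apply is_series_unique, is_series_shift_seq, Series_correct, l2_prop.
Qed.

Lemma shift_is_linear : is_linear shift_fun.
Proof.
split.
- intros x y; apply l2_eq; intros [|n]; c_ring.
- intros c x; apply l2_eq; intros [|n]; c_ring.
- exists 1; split; [lra|]; intros x; rewrite Rmult_1_l.
  apply Req_le, shift_norm.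
Qed.

Definition shift : bounded_op l2_NormedModule := Bounded_op shift_fun shift_is_linear.

Definition in_linf (u : nat -> C) : Prop := exists M, forall n, Cmod (u n) <= M.

Lemma in_l2_mult_linf (u : nat -> C) (x : l2) : in_linf u -> in_l2 (fun n => Cmult (u n) (x n)).
Proof. intros [M h]; apply (in_l2_mult_bounded u x M h), l2_prop. Qed.

Definition diag_fun (u : nat -> C) (hu : in_linf u) (x : l2) : l2 :=
  L2 _ (in_l2_mult_linf u x hu).

Lemma diag_is_linear u hu : is_linear (diag_fun u hu).
Proof.
split.
- intros x y; apply l2_eq; intros n; c_ring.
- intros c x; apply l2_eq; intros n; c_ring.
- destruct (hu) as [M h]; exists (Rabs M + 1).
  assert (hM := Rabs_pos M); split; [lra|]; intros x.
  change (l2_norm (diag_fun u hu x) <= (Rabs M + 1) * l2_norm x).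
  assert (hx := l2_norm_ge0 x).
  apply Rsqr_incr_0_var; [|apply Rmult_le_pos; lra].
  rewrite !Rsqr_pow2, Rpow_mult_distr, !l2_norm_sqr, <- Series_scal_l.
  apply Series_le; [|apply (ex_series_scal_l (V := R_NormedModule)), l2_prop].
  intros n; split; [apply pow2_ge_0|]; simpl l2_seq.
  rewrite Cmod_mult, Rpow_mult_distr.
  apply Rmult_le_compat_r; [apply pow2_ge_0|].
  apply pow_incr; split; [apply Cmod_ge_0|].
  specialize (h n); assert (h' := Rle_abs M); lra.
Qed.

Definition diag (u : nat -> C) (hu : in_linf u) : bounded_op l2_NormedModule :=
  Bounded_op (diag_fun u hu) (diag_is_linear u hu).

Lemma theta_is_linear (x y : l2) : is_linear (fun z : l2 => scal (inner z y) x).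
Proof.
split.
- intros a b; rewrite inner_plus_l; exact (scal_distr_r (V := l2_ModuleSpace) _ _ _).
- intros c a; rewrite inner_scal_l; symmetry; exact (scal_assoc (V := l2_ModuleSpace) _ _ _).
- assert (hx := l2_norm_ge0 x); assert (hy := l2_norm_ge0 y).
  exists (2 * (l2_norm y * l2_norm x) + 1); split.
  { assert (h := Rmult_le_pos _ _ hy hx); lra. }
  intros z; change (l2_norm (l2_scal (inner z y) x)
    <= (2 * (l2_norm y * l2_norm x) + 1) * l2_norm z).
  rewrite l2_norm_scal.
  assert (h := inner_bound z y); assert (hz := l2_norm_ge0 z).
  apply (Rle_trans _ (2 * (l2_norm z * l2_norm y) * l2_norm x));
    [apply Rmult_le_compat_r; trivial|nra].
Qed.

Definition theta (x y : l2) : bounded_op l2_NormedModule :=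
  Bounded_op (fun z => scal (inner z y) x) (theta_is_linear x y).

Definition basis_seq (k n : nat) : C := if Nat.eqb n k then 1%C else 0%C.

Lemma in_l2_basis k : in_l2 (basis_seq k).
Proof.
apply (ex_series_incr_n (V := R_NormedModule) _ (S k)).
apply ex_series_ext with (2 := in_l2_0); intros n; unfold basis_seq.
replace (Nat.eqb (S k + n) k) with false; trivial.
symmetry; apply Nat.eqb_neq; lia.
Qed.

Definition basis (k : nat) : l2 := L2 _ (in_l2_basis k).

Definition orthogonal (P : l2 -> Prop) (x : l2) : Prop := forall y, P y -> inner x y = 0%C.

(* The graph of B (A restricted to (ker A)^perp)^-1. *)
Definition quotient_graph (B A : bounded_op l2_NormedModule) (u v : l2) : Prop :=
  exists x : l2, orthogonal (ker A) x /\ A x = u /\ B x = v.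

Lemma orthogonal_zero P : orthogonal P zero.
Proof.
intros y _; replace (inner zero y) with (inner (scal (RtoC 0 : C_Ring) l2_zero) y)
  by (f_equal; apply l2_eq; intros n; c_ring).
rewrite inner_scal_l; apply Cmult_0_l.
Qed.

Lemma orthogonal_plus P x y : orthogonal P x -> orthogonal P y -> orthogonal P (plus x y).
Proof.
intros hx hy z hz; rewrite inner_plus_l, hx, hy; trivial; apply Cplus_0_l.
Qed.

Lemma orthogonal_scal P c x : orthogonal P x -> orthogonal P (scal c x).
Proof. intros hx z hz; rewrite inner_scal_l, hx; trivial; apply Cmult_0_r. Qed.

Lemma quotient_graph_fun B A u v v' :
  quotient_graph B A u v -> quotient_graph B A u v' -> v = v'.
Proof.
intros [x [hx [<- <-]]] [x' [hx' [e <-]]].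
enough (h : minus x x' = zero).
{ assert (e' : x = x'); [|rewrite e'; trivial].
  apply (plus_reg_r (opp x')); rewrite plus_opp_r; exact h. }
assert (hk : ker A (minus x x')).
{ transitivity (minus (A x) (A x')).
  - exact (linear_minus (bop_fun A) x x' (bop_linear A)).
  - rewrite e; exact (minus_eq_zero _). }
assert (ho : orthogonal (ker A) (minus x x')).
{ apply orthogonal_plus; trivial.
  exact (orthogonal_scal _ (Copp 1%C) x' hx'). }
assert (h := ho _ hk); rewrite inner_self in h; apply RtoC_inj in h.
apply (l2_norm_eq0 (minus x x')).
apply Rsqr_0_uniq; rewrite Rsqr_pow2; exact h.
Qed.

Lemma quotient_graph_zero B A : quotient_graph B A zero zero.
Proof.
exists zero; split; [apply orthogonal_zero|].
split; [exact (linear_zero _ (bop_linear A))|exact (linear_zero _ (bop_linear B))].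
Qed.

Lemma quotient_graph_plus B A u v u' v' :
  quotient_graph B A u v -> quotient_graph B A u' v' ->
  quotient_graph B A (plus u u') (plus v v').
Proof.
intros [x [hx [<- <-]]] [x' [hx' [<- <-]]].
exists (plus x x'); split; [apply orthogonal_plus; trivial|].
split; [exact (linear_plus _ (bop_linear A) x x')|exact (linear_plus _ (bop_linear B) x x')].
Qed.

Lemma quotient_graph_scal B A (c : C) u v :
  quotient_graph B A u v -> quotient_graph B A (scal c u) (scal c v).
Proof.
intros [x [hx [<- <-]]].
exists (scal c x); split; [apply orthogonal_scal; trivial|].
split; [exact (linear_scal _ (bop_linear A) c x)|exact (linear_scal _ (bop_linear B) c x)].
Qed.

Definition quotient (B A : bounded_op l2_NormedModule) : operator l2_NormedModule :=
  Operator (quotient_graph B A) (quotient_graph_fun B A) (quotient_graph_zero B A)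
    (quotient_graph_plus B A) (quotient_graph_scal B A).

(* Main.v *)
Require Import Defs.
From Stdlib Require Import Reals Lra Lia Classical.
From Coquelicot Require Import Coquelicot.

Open Scope R_scope.

(** Write [e_0, e_1, ...] for the basis vectors, [phi x] for the sum of the
    [x_n w_n], and [q_n] for the conjugate of [w_n / lambda_n]. The operator [A] is
    given by [(A x)_0 = phi x] and [(A x)_(n+1) = lambda_n x_n].

    Kernel. If [A x = 0], every [lambda_n x_n] vanishes; as at most one weight is 0,
    [x] is a multiple of a single [e_k], and [phi e_k = w_k] is not 0
    ([perturbed_shift_ker]).

    Closedness. The backward shift is a bounded left inverse of [B = S]; this
    describes the graph of the quotient by equations between bounded operators
    ([closed_quotient]).

    Commutant. An operator [R] commutes with the quotient only if for each [x] there
    is [y] with [R A x = A y] and [R B x = B y]. For [x = e_j] this is a system of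
    equations on the columns of the matrix of [R]; because the weights are distinct
    and no [w_j] vanishes, its only solutions are the scalar matrices
    ([commutant_perturbed_shift]). A bounded operator is determined by its matrix
    since the basis vectors span a dense subspace ([bounded_op_ext_basis]).

    Density. The domain is the range of [A]. It misses a neighbourhood of [e_(k+1)]
    if [lambda_k = 0]. If no weight vanishes and [q] is in l^2, the functional
    [u |-> u_0 - (S^* u | q)] is bounded, vanishes on the range, and is 1 at [e_0]
    ([dense_range_not_l2]). If [q] is not in l^2, then [e_0] is a limit of explicit
    elements of the range ([adherent_range_basis_0]), built from the first
    coordinates of [q]; the other basis vectors follow, because
    [A e_n = lambda_n e_(n+1) + w_n e_0] ([dense_range]). *)

(* Proves an equation between two coordinates of elements of l^2. *)
Local Ltac c_ring :=
  simpl; lazymatch goal with |- @eq _ ?a ?b => change (@eq C a b) end;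
  unfold minus, mult, plus, opp, one, zero; simpl; ring.

(** * Bounded operators and closed quotients *)

Definition bop_scalar {H : NormedModule C_AbsRing} (c : C) : bounded_op H :=
  Bounded_op (fun x => scal c x) (is_linear_scal_r (K := C_AbsRing) c Cmult_comm).

Lemma closed_ker_linear (U V : NormedModule C_AbsRing) (f : U -> V) :
  is_linear f -> closed (fun x => f x = zero).
Proof.
intros hf; apply (closed_ext (fun x => norm (f x) = 0)).
{ intros x; split; [apply norm_eq_zero|intros ->; apply norm_zero]. }
apply (closed_comp (fun x => norm (f x)) (fun r => r = 0)); [|apply closed_eq].
intros x; apply (filterlim_comp _ _ _ f norm _ (locally (f x)));
  [apply (linear_cont f x hf)|apply filterlim_norm].
Qed.

Lemma closed_eq_linear (U V : NormedModule C_AbsRing) (f g : U -> V) :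
  is_linear f -> is_linear g -> closed (fun x => f x = g x).
Proof.
intros hf hg; apply (closed_ext (fun x => plus (f x) (opp (g x)) = zero)).
{ intros x; split; intros h.
  - apply (plus_reg_r (opp (g x))); rewrite plus_opp_r; exact h.
  - rewrite h; exact (plus_opp_r (G := NormedModule.AbelianGroup C_AbsRing V) (g x)). }
apply (closed_ker_linear U V (fun x => plus (f x) (opp (g x)))).
apply (is_linear_comp (fun x => (f x, opp (g x))) (fun p => plus (fst p) (snd p)));
  [|apply is_linear_plus].
apply is_linear_prod; trivial.
apply (is_linear_comp g opp); trivial; apply is_linear_opp.
Qed.

Lemma inner_zero_r (x : l2) : inner x zero = RtoC 0.
Proof.
assert (h := inner_bound x l2_zero).
apply Cmod_eq_0, Rle_antisym; [|apply Cmod_ge_0].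
change (zero : l2) with l2_zero.
assert (e : l2_norm l2_zero = 0) by exact (norm_zero (V := l2_NormedModule)).
rewrite e in h; lra.
Qed.

Lemma quotient_inj (B A : bounded_op l2_NormedModule) :
  (forall x, ker A x -> x = zero) ->
  forall u v, quotient B A u v <-> exists x, A x = u /\ B x = v.
Proof.
intros hA u v; split.
- intros [x [_ h]]; exists x; exact h.
- intros [x h]; exists x; split; trivial.
  intros y hy; rewrite (hA y hy); apply inner_zero_r.
Qed.

Lemma dom_quotient (B A : bounded_op l2_NormedModule) :
  (forall x, ker A x -> x = zero) ->
  forall u, dom (quotient B A) u <-> exists x, A x = u.
Proof.
intros hA u; split.
- intros [v [x [_ [h _]]]]; exists x; exact h.
- intros [x h]; exists (B x); apply quotient_inj; trivial; exists x; split; trivial.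
Qed.

(** A bounded left inverse [L] of [B] makes the graph the set of the (u, v) with
    u = A (L v) and v = B (L v), which is closed because the three operators are
    bounded. *)
Lemma closed_quotient (B A L : bounded_op l2_NormedModule) :
  (forall x, ker A x -> x = zero) -> (forall x, L (B x) = x) ->
  closed_op (quotient B A).
Proof.
intros hA hL; unfold closed_op.
apply (closed_ext (fun p : l2 * l2 => fst p = A (L (snd p)) /\ snd p = B (L (snd p)))).
- intros [u v]; rewrite quotient_inj by trivial; simpl; split.
  + intros [h1 h2]; exists (L v); split; congruence.
  + intros [x [<- <-]]; rewrite hL; split; trivial.
- assert (hs : is_linear (fun p : l2 * l2 => L (snd p))).
  { apply (is_linear_comp (fun p : l2 * l2 => snd p) L);
      [apply is_linear_snd|apply bop_linear]. }
  apply (closed_and (T := prod_UniformSpace l2_UniformSpace l2_UniformSpace)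
    (fun p => fst p = A (L (snd p))) (fun p => snd p = B (L (snd p)))).
  + apply (closed_eq_linear
      (prod_NormedModule C_AbsRing l2_NormedModule l2_NormedModule) l2_NormedModule
      (fun p => fst p) (fun p => A (L (snd p)))); [apply is_linear_fst|].
    apply (is_linear_comp (fun p : l2 * l2 => L (snd p)) A); trivial; apply bop_linear.
  + apply (closed_eq_linear
      (prod_NormedModule C_AbsRing l2_NormedModule l2_NormedModule) l2_NormedModule
      (fun p => snd p) (fun p => B (L (snd p)))); [apply is_linear_snd|].
    apply (is_linear_comp (fun p : l2 * l2 => L (snd p)) B); trivial; apply bop_linear.
Qed.

Lemma commutant_quotient (B A R : bounded_op l2_NormedModule) :
  (forall x, ker A x -> x = zero) -> in_commutant (quotient B A) R ->
  forall x, exists y, R (A x) = A y /\ R (B x) = B y.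
Proof.
intros hA [hd hc] x.
assert (hx : quotient B A (A x) (B x)).
{ apply quotient_inj; trivial; exists x; split; trivial. }
destruct (hd (A x)) as [z hz]; [exists (B x); trivial|].
assert (e := hc _ _ _ hx hz); rewrite quotient_inj in hz by trivial.
destruct hz as [y [h1 h2]]; exists y; split; congruence.
Qed.

(** * Series with finitely many terms and coordinates in l^2 *)

Lemma Series_finite (a : nat -> R) N :
  (forall n, (N < n)%nat -> a n = 0) -> Series a = sum_n a N.
Proof.
intros h.
assert (hz : forall k, a (S N + k)%nat = 0) by (intros k; apply h; lia).
assert (e0 : is_series (fun k => a (S N + k)%nat) 0).
{ apply (is_series_ext (fun _ => 0)); [intros; symmetry; apply hz|].
  apply (filterlim_ext (fun _ => 0)); [|apply filterlim_const].
  intros n; rewrite sum_n_const; ring. }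
rewrite (Series_incr_n a (S N)); [|lia|].
- rewrite (is_series_unique _ _ e0), Rplus_0_r; symmetry; apply sum_n_Reals.
- apply (ex_series_incr_n (V := R_NormedModule) a (S N)); exists 0; exact e0.
Qed.

Lemma Series_single (a : nat -> R) k : (forall n, n <> k -> a n = 0) -> Series a = a k.
Proof.
intros h; rewrite (Series_incr_n_aux a k) by (intros; apply h; lia).
rewrite (Series_finite _ 0) by (intros; apply h; lia).
rewrite sum_O; f_equal; lia.
Qed.

Lemma minus_coord (x y : l2) n : (minus x y : l2) n = Cminus (x n) (y n).
Proof. c_ring. Qed.

Lemma inner_basis k (y : l2) : inner (basis k) y = Cconj (y k).
Proof.
assert (e : forall n, (basis k : l2) n = if Nat.eqb n k then RtoC 1 else RtoC 0) by reflexivity.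
unfold inner; rewrite (Series_single _ k), (Series_single (fun n => Im _) k).
- rewrite e, Nat.eqb_refl, Cmult_1_l; symmetry; apply surjective_pairing.
- intros n hn; rewrite e; apply Nat.eqb_neq in hn; rewrite hn, Cmult_0_l; reflexivity.
- intros n hn; rewrite e; apply Nat.eqb_neq in hn; rewrite hn, Cmult_0_l; reflexivity.
Qed.

(** The sequence [u] need not be square summable: the density of the range is
    proved with such vectors for a [u] outside l^2. *)
Definition finite_part (N : nat) (u : nat -> C) : l2 :=
  sum_n (fun k => scal (u k : C_Ring) (basis k)) N.

Lemma finite_part_coord N u n :
  finite_part N u n = if Nat.leb n N then u n else RtoC 0.
Proof.
unfold finite_part; induction N as [|N IH].
- rewrite sum_O; change (scal (u 0%nat : C_Ring) (basis 0) : l2) with (l2_scal (u 0%nat) (basis 0)).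
  simpl; unfold basis_seq; destruct n as [|n]; simpl; ring.
- rewrite sum_Sn.
  transitivity (Cplus ((sum_n (fun k => scal (u k : C_Ring) (basis k)) N : l2) n)
    (Cmult (u (S N)) (basis_seq (S N) n))); [reflexivity|].
  rewrite IH; unfold basis_seq.
  destruct (Nat.eqb_spec n (S N)) as [->|ne].
  + rewrite Nat.leb_refl; replace (Nat.leb (S N) N) with false; [ring|].
    symmetry; apply Nat.leb_gt; lia.
  + destruct (Nat.leb_spec n N), (Nat.leb_spec n (S N)); try lia; ring.
Qed.

Lemma inner_finite_part N u (y : l2) :
  inner (finite_part N u) y = sum_n (fun k => Cmult (u k) (Cconj (y k)) : C) N.
Proof.
unfold finite_part; induction N as [|N IH].
- rewrite !sum_O, inner_scal_l, inner_basis; reflexivity.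
- rewrite !sum_Sn, inner_plus_l, IH, inner_scal_l, inner_basis; reflexivity.
Qed.

Lemma finite_part_norm N u :
  l2_norm (finite_part N u) ^ 2 = sum_n (fun k => Cmod (u k) ^ 2) N.
Proof.
rewrite l2_norm_sqr, (Series_finite _ N).
- apply sum_n_ext_loc; intros n hn; rewrite finite_part_coord.
  replace (Nat.leb n N) with true; trivial; symmetry; apply Nat.leb_le; trivial.
- intros n hn; rewrite finite_part_coord.
  replace (Nat.leb n N) with false by (symmetry; apply Nat.leb_gt; trivial).
  rewrite Cmod_0; ring.
Qed.

Lemma finite_part_cvg (x : l2) (eps : posreal) :
  exists N, ball (x : l2_UniformSpace) eps (finite_part N x).
Proof.
assert (hx := Series_correct _ (l2_prop x)).
assert (he : 0 < eps ^ 2) by (apply pow_lt, cond_pos).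
destruct (proj1 (filterlim_locally (U := R_UniformSpace) _ _) hx (mkposreal _ he))
  as [N hN].
exists N; change (l2_norm (minus (finite_part N x) x) < eps).
specialize (hN N (le_n N)); change (Rabs (sum_n (fun n => Cmod (x n) ^ 2) N
  - Series (fun n => Cmod (x n) ^ 2)) < eps ^ 2) in hN.
(* The first N + 1 coordinates of the difference vanish. *)
assert (hs : l2_norm (minus (finite_part N x) x) ^ 2
  = Series (fun n => Cmod (x n) ^ 2) - sum_n (fun n => Cmod (x n) ^ 2) N).
{ assert (ec := minus_coord (finite_part N x) x).
  rewrite l2_norm_sqr, (Series_incr_n_aux _ (S N)).
  - rewrite (Series_incr_n (fun n => Cmod (x n) ^ 2) (S N)); [|lia|apply l2_prop].
    rewrite <- sum_n_Reals; simpl Init.Nat.pred.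
    match goal with |- ?a = ?b + ?c - ?d => replace (b + c - d) with c by ring end.
    apply Series_ext; intros k; rewrite ec, finite_part_coord.
    replace (Nat.leb (S N + k) N) with false by (symmetry; apply Nat.leb_gt; lia).
    f_equal; rewrite <- (Cmod_opp (x _)); f_equal; ring.
  - intros k hk; rewrite ec, finite_part_coord.
    replace (Nat.leb k N) with true by (symmetry; apply Nat.leb_le; lia).
    replace (Cminus (x k) (x k)) with (RtoC 0) by ring.
    rewrite Cmod_0; ring. }
apply Rsqr_incrst_0; [|apply l2_norm_ge0|apply Rlt_le, cond_pos].
rewrite !Rsqr_pow2, hs.
apply Rabs_def2 in hN; lra.
Qed.

(** * Density of subspaces of l^2 *)

Definition adherent (P : l2 -> Prop) (x : l2) : Prop :=
  forall eps : posreal, exists y, P y /\ ball (x : l2_UniformSpace) eps y.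

Lemma adherent_idem P x : adherent (adherent P) x -> adherent P x.
Proof.
intros h eps; destruct (h (pos_div_2 eps)) as [y [hy hxy]].
destruct (hy (pos_div_2 eps)) as [z [hz hyz]].
exists z; split; trivial.
rewrite <- (Rplus_half_diag eps); exact (ball_triangle _ _ _ _ _ hxy hyz).
Qed.

Lemma adherent_of P x : P x -> adherent P x.
Proof. intros h eps; exists x; split; trivial; apply ball_center. Qed.

Lemma adherent_plus (P : l2 -> Prop) x y :
  (forall a b, P a -> P b -> P (plus a b)) ->
  adherent P x -> adherent P y -> adherent P (plus x y).
Proof.
intros hP hx hy eps.
destruct (hx (pos_div_2 eps)) as [a [ha hxa]].
destruct (hy (pos_div_2 eps)) as [b [hb hyb]].
exists (plus a b); split; [apply hP; trivial|].
change (l2_norm (minus (plus a b) (plus x y)) < eps).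
change (l2_norm (minus a x) < eps / 2) in hxa; change (l2_norm (minus b y) < eps / 2) in hyb.
replace (minus (plus a b) (plus x y)) with (l2_plus (minus a x) (minus b y))
  by (apply l2_eq; intros n; c_ring).
assert (h := l2_norm_triangle (minus a x) (minus b y)); lra.
Qed.

Lemma adherent_scal (P : l2 -> Prop) (c : C) x :
  (forall a, P a -> P (l2_scal c a)) ->
  adherent P x -> adherent P (l2_scal c x).
Proof.
intros hP hx eps.
assert (hc : 0 < Cmod c + 1) by (assert (h := Cmod_ge_0 c); lra).
assert (he : 0 < eps / (Cmod c + 1)) by (apply Rdiv_lt_0_compat; trivial; apply cond_pos).
destruct (hx (mkposreal _ he)) as [a [ha hxa]].
exists (l2_scal c a); split; [apply hP; trivial|].
change (l2_norm (minus (l2_scal c a) (l2_scal c x)) < eps).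
change (l2_norm (minus a x) < eps / (Cmod c + 1)) in hxa.
replace (minus (l2_scal c a) (l2_scal c x)) with (l2_scal c (minus a x))
  by (apply l2_eq; intros n; c_ring).
rewrite l2_norm_scal.
apply (Rmult_lt_compat_r _ _ _ hc) in hxa.
unfold Rdiv in hxa; rewrite Rmult_assoc, Rinv_l, Rmult_1_r in hxa by lra.
assert (h := Cmod_ge_0 c); assert (h' := l2_norm_ge0 (minus a x)); nra.
Qed.

(** The closure of a subspace is a subspace; once it contains the basis vectors it
    contains the finite parts of every vector, which converge to it. *)
Lemma dense_of_basis (P : l2 -> Prop) :
  (forall a b, P a -> P b -> P (plus a b)) ->
  (forall c a, P a -> P (l2_scal c a)) ->
  (forall k, adherent P (basis k)) -> forall x, adherent P x.
Proof.
intros hp hs hb x; apply adherent_idem; intros eps.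
destruct (finite_part_cvg x eps) as [N hN]; exists (finite_part N x); split; trivial.
unfold finite_part; clear hN; induction N as [|N IH].
- rewrite sum_O; apply adherent_scal; trivial; apply hs.
- rewrite sum_Sn; apply adherent_plus; trivial.
  apply adherent_scal; trivial; apply hs.
Qed.

Lemma bounded_op_ext_basis (R R' : bounded_op l2_NormedModule) :
  (forall k, R (basis k) = R' (basis k)) -> forall x, R x = R' x.
Proof.
intros h x.
apply (closed_eq_linear l2_NormedModule l2_NormedModule R R'
  (bop_linear R) (bop_linear R')).
intros [eps he].
destruct (dense_of_basis (fun y => R y = R' y)) with (x := x) (eps := eps)
  as [y [hy hxy]].
- intros a b ha hb.
  assert (e := linear_plus R (bop_linear R) a b).
  assert (e' := linear_plus R' (bop_linear R') a b).
  rewrite ha, hb in e; exact (eq_trans e (eq_sym e')).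
- intros c a ha.
  assert (e := linear_scal R (bop_linear R) c a).
  assert (e' := linear_scal R' (bop_linear R') c a).
  rewrite ha in e; exact (eq_trans e (eq_sym e')).
- intros k; apply adherent_of, h.
- exact (he y hxy hy).
Qed.

(** * The backward shift *)

Lemma in_l2_unshift (x : l2) : in_l2 (fun n => x (S n)).
Proof.
apply (ex_series_incr_1 (V := R_NormedModule) (fun n => Cmod (x n) ^ 2)), l2_prop.
Qed.

Definition unshift_fun (x : l2) : l2 := L2 _ (in_l2_unshift x).

Lemma unshift_norm x : l2_norm (unshift_fun x) <= l2_norm x.
Proof.
apply Rsqr_incr_0_var; [|apply l2_norm_ge0].
rewrite !Rsqr_pow2, !l2_norm_sqr, (Series_incr_1 (fun n => Cmod (x n) ^ 2)) by apply l2_prop.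
assert (h := pow2_ge_0 (Cmod (x 0%nat))); simpl in *; lra.
Qed.

Lemma unshift_is_linear : is_linear unshift_fun.
Proof.
split.
- intros x y; apply l2_eq; intros n; c_ring.
- intros c x; apply l2_eq; intros n; c_ring.
- exists 1; split; [lra|]; intros x; rewrite Rmult_1_l; apply unshift_norm.
Qed.

Definition unshift : bounded_op l2_NormedModule := Bounded_op unshift_fun unshift_is_linear.

Lemma unshift_shift x : unshift (shift x) = x.
Proof. apply l2_eq; intros n; reflexivity. Qed.

(** * The perturbed weighted shift *)

Section PerturbedShift.

Context (lambda : nat -> C) (hlambda : in_linf lambda).
Context (w : nat -> C) (hw : in_l2 (fun n => Cconj (w n))).

Let wbar : l2 := L2 (fun n => Cconj (w n)) hw.

Definition perturbed_shift : bounded_op l2_NormedModule :=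
  bop_plus (bop_comp shift (diag lambda hlambda)) (theta (basis 0) wbar).

Let A := perturbed_shift.

Lemma perturbed_shift_0 (x : l2) : (A x : l2) 0%nat = inner x wbar.
Proof.
transitivity (Cplus 0 (Cmult (inner x wbar) 1)); [reflexivity|ring].
Qed.

Lemma perturbed_shift_S (x : l2) n : (A x : l2) (S n) = Cmult (lambda n) (x n).
Proof.
transitivity (Cplus (lambda n * x n) (Cmult (inner x wbar) 0)); [reflexivity|ring].
Qed.

Lemma perturbed_shift_basis k :
  A (basis k) = plus (l2_scal (lambda k) (basis (S k))) (l2_scal (w k) (basis 0)).
Proof.
apply l2_eq; intros [|n].
- rewrite perturbed_shift_0, inner_basis; simpl l2_seq at 1; rewrite Cconj_conj.
  transitivity (Cplus (lambda k * 0) (w k * 1)); [ring|reflexivity].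
- rewrite perturbed_shift_S.
  transitivity (Cplus (lambda k * basis_seq k n) (w k * 0)); [|reflexivity].
  simpl l2_seq; unfold basis_seq.
  destruct (Nat.eqb_spec n k) as [->|ne]; ring.
Qed.

Lemma shift_basis k : shift (basis k) = basis (S k).
Proof. apply l2_eq; intros [|n]; reflexivity. Qed.

Lemma inner_supported_at (x : l2) k :
  (forall n, n <> k -> x n = RtoC 0) ->
  x = l2_scal (x k) (basis k) /\ inner x wbar = Cmult (x k) (w k).
Proof.
intros h.
assert (e : x = l2_scal (x k) (basis k)).
{ apply l2_eq; intros n; simpl; unfold basis_seq.
  destruct (Nat.eqb_spec n k) as [->|ne]; [ring|rewrite h by trivial; ring]. }
split; trivial.
rewrite e at 1; change (l2_scal (x k) (basis k)) with (scal (x k : C_Ring) (basis k)).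
rewrite inner_scal_l, inner_basis; simpl l2_seq at 2; rewrite Cconj_conj; reflexivity.
Qed.

Hypothesis hw0 : forall n, w n <> RtoC 0.

Section DistinctWeights.

Hypothesis hinj : forall i j : nat, i <> j -> lambda i <> lambda j.

(** At most one weight vanishes, so that a vector in the kernel is a multiple of a
    single basis vector; the perturbation does not kill that one. *)
Lemma perturbed_shift_ker x : ker A x -> x = zero.
Proof.
intros h; unfold ker in h.
assert (hS : forall n, Cmult (lambda n) (x n) = RtoC 0).
{ intros n; rewrite <- perturbed_shift_S, h; reflexivity. }
assert (h0 : inner x wbar = RtoC 0).
{ rewrite <- perturbed_shift_0, h; reflexivity. }
assert (hx : forall k, x k = RtoC 0).
{ intros k; destruct (classic (x k = RtoC 0)) as [e|ne]; trivial.
  assert (hk : lambda k = RtoC 0).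
  { destruct (classic (lambda k = RtoC 0)) as [e|ne']; trivial.
    destruct (Cmult_neq_0 _ _ ne' ne (hS k)). }
  destruct (inner_supported_at x k) as [_ e].
  - intros n hn; destruct (classic (x n = RtoC 0)) as [e|ne']; trivial.
    destruct (Cmult_neq_0 (lambda n) (x n)); trivial.
    rewrite <- hk; apply hinj; trivial.
  - rewrite h0 in e; destruct (Cmult_neq_0 _ _ ne (hw0 k)); symmetry; exact e. }
apply l2_eq; exact hx.
Qed.

(** Let [R A e_j = A y] and [R S e_j = S y]. Applying [R] to
    [A e_j = lambda_j e_(j+1) + w_j e_0] gives
    [A y = lambda_j S y + w_j R e_0]. The coordinates i + 1 of both sides are
    [lambda_i y_i] and [lambda_j y_i + w_j (R e_0)_(i+1)]: the case i = j says that
    [R e_0] is a multiple [c e_0], and then the case i <> j that [y] is a multiple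
    of [e_j]. The coordinates 0 are [w_j y_j] and [w_j c]. *)
Lemma commutant_perturbed_shift (R : bounded_op l2_NormedModule) :
  in_commutant (quotient shift A) R -> scalar_op R.
Proof.
intros hR.
assert (hy := commutant_quotient shift A R perturbed_shift_ker hR).
set (r := R (basis 0) : l2).
assert (hcol : forall j, exists y : l2, R (basis (S j)) = shift y /\
  inner y wbar = Cmult (w j) (r 0%nat) /\
  forall i, Cmult (lambda i) (y i) = Cplus (Cmult (lambda j) (y i)) (Cmult (w j) (r (S i)))).
{ intros j; destruct (hy (basis j)) as [y [h1 h2]].
  rewrite shift_basis in h2; exists y; split; trivial.
  assert (e : A y = plus (l2_scal (lambda j) (shift y)) (l2_scal (w j) r)).
  { rewrite <- h1, perturbed_shift_basis.
    refine (eq_trans (linear_plus R (bop_linear R) _ _) _).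
    assert (e1 := linear_scal R (bop_linear R) (lambda j) (basis (S j))).
    assert (e2 := linear_scal R (bop_linear R) (w j) (basis 0)).
    rewrite h2 in e1; exact (f_equal2 plus e1 e2). }
  split; [|intros i].
  - rewrite <- perturbed_shift_0, e.
    transitivity (Cplus (lambda j * 0) (w j * r 0%nat)); [reflexivity|ring].
  - rewrite <- perturbed_shift_S, e; reflexivity. }
(* The case i = j of the coordinates i + 1. *)
assert (hr : forall j, r (S j) = RtoC 0).
{ intros j; destruct (hcol j) as [y [_ [_ h]]].
  destruct (classic (r (S j) = RtoC 0)) as [e|ne]; trivial.
  destruct (Cmult_neq_0 _ _ (hw0 j) ne).
  transitivity (Cminus (lambda j * y j + w j * r (S j)) (lambda j * y j)); [ring|].
  rewrite <- h; ring. }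
exists (r 0%nat).
apply (bounded_op_ext_basis R (bop_scalar (r 0%nat))); intros [|j].
- apply l2_eq; intros n.
  transitivity (Cmult (r 0%nat) (basis_seq 0 n)); [|reflexivity].
  change (r n = Cmult (r 0%nat) (basis_seq 0 n)).
  destruct n as [|n]; simpl; [|rewrite hr]; unfold basis_seq; simpl; ring.
- destruct (hcol j) as [y [-> [h0 h]]].
  destruct (inner_supported_at y j) as [e hi].
  + intros n hn; destruct (classic (y n = RtoC 0)) as [e|ne]; trivial.
    destruct (Cmult_neq_0 (Cminus (lambda n) (lambda j)) (y n)); trivial.
    * intros h'; apply (hinj n j hn).
      transitivity (Cplus (Cminus (lambda n) (lambda j)) (lambda j)); [ring|].
      rewrite h'; ring.
    * transitivity (Cminus (lambda n * y n) (lambda j * y n)); [ring|].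
      rewrite h, hr; ring.
  + assert (ey : y j = r 0%nat).
    { rewrite hi in h0.
      transitivity (Cmult (Cmult (y j) (w j)) (Cinv (w j))); [field; apply hw0|].
      rewrite h0; field; apply hw0. }
    rewrite e, ey.
    refine (eq_trans (linear_scal shift (bop_linear shift) (r 0%nat) (basis j)) _).
    rewrite shift_basis; reflexivity.
Qed.

End DistinctWeights.

(** * Density of the range *)

Let range (u : l2) : Prop := exists x, A x = u.

Lemma range_plus a b : range a -> range b -> range (plus a b).
Proof.
intros [x <-] [y <-]; exists (plus x y); exact (linear_plus A (bop_linear A) x y).
Qed.

Lemma range_scal c a : range a -> range (l2_scal c a).
Proof.
intros [x <-]; exists (scal (c : C_Ring) x); exact (linear_scal A (bop_linear A) c x).
Qed.

(** If [lambda_k = 0], the coordinate k + 1 vanishes on the range of [A]. *)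
Lemma dense_range_weight_neq0 :
  (forall x, adherent range x) -> forall k, lambda k <> RtoC 0.
Proof.
intros h k hk; destruct (h (basis (S k)) (mkposreal 1 Rlt_0_1)) as [u [[x <-] hu]].
change (l2_norm (minus (A x) (basis (S k))) < 1) in hu.
assert (hc := l2_coord_le_norm (minus (A x) (basis (S k))) (S k)).
replace ((minus (A x) (basis (S k)) : l2) (S k)) with (Copp 1) in hc.
- rewrite Cmod_opp, Cmod_1 in hc; lra.
- transitivity (Cminus ((A x : l2) (S k)) (basis_seq (S k) (S k))).
  + rewrite perturbed_shift_S, hk; unfold basis_seq; rewrite Nat.eqb_refl; ring.
  + symmetry; exact (minus_coord (A x) (basis (S k)) (S k)).
Qed.

(** For [q] the conjugate of w / lambda, the functional [u |-> u_0 - (S^* u | q)] is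
    bounded by [1 + 2 |q|], vanishes on the range of [A], and is 1 at [e_0]; so the
    distance from [e_0] to the range is at least [1 / (1 + 2 |q|)]. *)
Lemma dense_range_not_l2 :
  (forall k, lambda k <> RtoC 0) -> (forall x, adherent range x) ->
  ~ in_l2 (fun k => Cdiv (w k) (lambda k)).
Proof.
intros hl h hwl.
assert (hq : in_l2 (fun k => Cconj (Cdiv (w k) (lambda k)))).
{ revert hwl; apply ex_series_ext; intros n; rewrite Cmod_conj; trivial. }
set (q := L2 _ hq).
assert (hA : forall x, (A x : l2) 0%nat = inner (unshift (A x)) q).
{ intros x; rewrite perturbed_shift_0; unfold inner.
  assert (e : forall n, Cmult (x n) (Cconj (wbar n))
     = Cmult ((unshift (A x) : l2) n) (Cconj (q n))).
  { intros n; change ((unshift (A x) : l2) n) with ((A x : l2) (S n)).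
    rewrite perturbed_shift_S; unfold wbar, q; simpl l2_seq; rewrite !Cconj_conj.
    field; apply hl. }
  f_equal; apply Series_ext; intros n; rewrite e; trivial. }
assert (hd : 0 < 1 + 2 * l2_norm q) by (assert (h' := l2_norm_ge0 q); lra).
assert (he : 0 < / (1 + 2 * l2_norm q)) by (apply Rinv_0_lt_compat; trivial).
destruct (h (basis 0) (mkposreal _ he)) as [u [[x <-] hu]].
set (d := minus (A x) (basis 0) : l2).
change (l2_norm d < / (1 + 2 * l2_norm q)) in hu.
assert (e : d 0%nat = Cminus (inner (unshift d) q) 1).
{ replace (unshift d) with (unshift (A x)).
  2: { apply l2_eq; intros n.
    transitivity (Cminus ((A x : l2) (S n)) 0);
      [|symmetry; exact (minus_coord (A x) (basis 0) (S n))].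
    change (unshift (A x) n) with ((A x : l2) (S n)); ring. }
  rewrite <- hA; exact (minus_coord (A x) (basis 0) 0). }
assert (h1 : 1 <= Cmod (d 0%nat) + Cmod (inner (unshift d) q)).
{ rewrite <- Cmod_1; replace (RtoC 1) with (Cplus (Copp (d 0%nat)) (inner (unshift d) q))
    by (rewrite e; ring).
  rewrite <- (Cmod_opp (d 0%nat)); apply Cmod_triangle. }
assert (h2 := l2_coord_le_norm d 0).
assert (h3 := inner_bound (unshift d) q).
assert (h4 : l2_norm (unshift d) * l2_norm q <= l2_norm d * l2_norm q)
  by (apply Rmult_le_compat_r; [apply l2_norm_ge0|apply unshift_norm]).
apply (Rmult_lt_compat_r _ _ _ hd) in hu; rewrite Rinv_l in hu by lra; nra.
Qed.

(** For [x_n = conj (w_n / lambda_n) / lambda_n], n <= N, the vector [A x] is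
    [s e_0] plus a vector of norm [sqrt s], where s is the N-th partial sum of the
    |w_n / lambda_n|^2. Hence [A (x / s)] is at distance [1 / sqrt s] from [e_0],
    and s can be taken as large as desired. *)
Lemma adherent_range_basis_0 :
  (forall k, lambda k <> RtoC 0) -> ~ in_l2 (fun k => Cdiv (w k) (lambda k)) ->
  adherent range (basis 0).
Proof.
intros hl hnl eps.
set (a := fun n => Cmod (Cdiv (w n) (lambda n)) ^ 2).
assert (heps := cond_pos eps).
assert (hN : exists N, / eps ^ 2 < sum_n a N).
{ apply NNPP; intros hN; apply hnl.
  destruct (ex_finite_lim_seq_incr (sum_n a) (/ eps ^ 2)) as [l hlim].
  - intros n; rewrite sum_Sn.
    assert (h := pow2_ge_0 (Cmod (Cdiv (w (S n)) (lambda (S n))))).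
    fold (a (S n)) in h; change (sum_n a n <= sum_n a n + a (S n)); lra.
  - intros n; apply Rnot_lt_le; intros h; apply hN; exists n; trivial.
  - exists l; exact hlim. }
destruct hN as [N hN]; set (s := sum_n a N) in *.
assert (he2 : 0 < eps ^ 2) by (apply pow_lt; trivial).
assert (hs : 0 < s) by (apply (Rlt_trans _ (/ eps ^ 2)); trivial; apply Rinv_0_lt_compat; trivial).
assert (hsC : RtoC s <> RtoC 0) by (intros h; apply RtoC_inj in h; lra).
set (q := fun n => Cconj (Cdiv (w n) (lambda n))).
set (x := finite_part N (fun n => Cdiv (q n) (lambda n))).
assert (h0 : inner x wbar = RtoC s).
{ unfold x; rewrite inner_finite_part; unfold s.
  assert (e : forall M, RtoC (sum_n a M) = sum_n (fun n => RtoC (a n)) M).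
  { induction M as [|M IH]; [rewrite !sum_O; trivial|].
    rewrite !sum_Sn, <- IH; apply RtoC_plus. }
  rewrite e; apply sum_n_ext; intros n; unfold wbar; simpl l2_seq; rewrite Cconj_conj.
  unfold a, q; rewrite Cmod2_conj.
  match goal with |- @eq _ ?b ?c => change (@eq C b c) end.
  field; apply hl. }
set (y := l2_scal (Cinv s) x).
exists (A y); split; [exists y; trivial|].
change (l2_norm (minus (A y) (basis 0)) < eps).
replace (minus (A y) (basis 0)) with (l2_scal (Cinv s) (shift (finite_part N q))).
- rewrite l2_norm_scal; change (l2_norm (shift (finite_part N q))) with (l2_norm (shift_fun (finite_part N q))).
  rewrite shift_norm, Cmod_inv by exact hsC; rewrite Cmod_R, Rabs_pos_eq by lra.
  assert (hq : l2_norm (finite_part N q) ^ 2 = s).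
  { rewrite finite_part_norm; apply sum_n_ext; intros n; unfold q, a.
    rewrite Cmod_conj; trivial. }
  apply Rsqr_incrst_0; [|apply Rmult_le_pos; [apply Rlt_le, Rinv_0_lt_compat|apply l2_norm_ge0]; lra|lra].
  rewrite !Rsqr_pow2, Rpow_mult_distr, hq.
  replace ((/ s) ^ 2 * s) with (/ s) by (field; lra).
  rewrite <- (Rinv_inv (eps ^ 2)).
  apply Rinv_lt_contravar; trivial.
  apply Rmult_lt_0_compat; trivial; apply Rinv_0_lt_compat; trivial.
- apply l2_eq; intros [|n].
  + transitivity (RtoC 0); [simpl; ring|].
    transitivity (Cminus ((A y : l2) 0%nat) 1); [|symmetry; exact (minus_coord (A y) (basis 0) 0)].
    rewrite perturbed_shift_0; unfold y.
    change (l2_scal (Cinv s) x) with (scal (Cinv s : C_Ring) x).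
    rewrite inner_scal_l, h0; field; trivial.
  + transitivity (Cmult (Cinv s) (finite_part N q n)); [reflexivity|].
    transitivity (Cminus ((A y : l2) (S n)) 0); [|symmetry; exact (minus_coord (A y) (basis 0) (S n))].
    rewrite perturbed_shift_S; change (y n) with (Cmult (Cinv s) (x n)).
    unfold x; rewrite !finite_part_coord.
    destruct (Nat.leb n N); field; [split; trivial|trivial].
Qed.

(** Every other basis vector is [lambda_n^-1 (A e_n - w_n e_0)]. *)
Lemma dense_range :
  (forall k, lambda k <> RtoC 0) -> ~ in_l2 (fun k => Cdiv (w k) (lambda k)) ->
  forall x, adherent range x.
Proof.
intros hl hnl; assert (h0 := adherent_range_basis_0 hl hnl).
apply dense_of_basis; [apply range_plus|apply range_scal|].
intros [|n]; trivial.
replace (basis (S n)) with (plus (l2_scal (Cinv (lambda n)) (A (basis n)))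
   (l2_scal (Copp (w n / lambda n)) (basis 0))).
- apply adherent_plus; [apply range_plus| |].
  + apply adherent_of, range_scal; exists (basis n); trivial.
  + apply adherent_scal; trivial; apply range_scal.
- rewrite perturbed_shift_basis; apply l2_eq; intros k; simpl.
  match goal with |- @eq _ ?a ?b => change (@eq C a b) end.
  unfold plus; simpl; field; apply hl.
Qed.

End PerturbedShift.

Theorem proposition3p8
  (lambda : nat -> C) (hlambda : in_linf lambda)
  (hinj : forall i j : nat, i <> j -> lambda i <> lambda j)
  (w : nat -> C) (hw : in_l2 (fun n => Cconj (w n)))
  (hw0 : forall n : nat, w n <> RtoC 0) :
  let A := bop_plus (bop_comp shift (diag lambda hlambda))
             (theta (basis 0) (L2 (fun n => Cconj (w n)) hw)) in
  let B := shift in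
  (forall x : l2, ker A x -> x = zero) /\
  transitive_op (quotient B A) /\
  (densely_defined (quotient B A) <->
    (forall k : nat, lambda k <> RtoC 0) /\
    ~ in_l2 (fun k => Cdiv (w k) (lambda k))).
Proof.
intros A B.
assert (hA := perturbed_shift_ker lambda hlambda w hw hw0 hinj).
split; [exact hA|split; [split|]].
- exact (closed_quotient B A unshift hA unshift_shift).
- exact (commutant_perturbed_shift lambda hlambda w hw hw0 hinj).
- assert (hd : densely_defined (quotient B A) <->
    forall x, adherent (fun u => exists y, A y = u) x).
  { split; intros h x eps; destruct (h x eps) as [u [hu hxu]]; exists u;
      (split; [apply (dom_quotient B A hA); exact hu|exact hxu]). }
  rewrite hd; split.
  + intros h.
    assert (hl := dense_range_weight_neq0 lambda hlambda w hw h).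
    split; [exact hl|exact (dense_range_not_l2 lambda hlambda w hw hl h)].
  + intros [hl hnl]; exact (dense_range lambda hlambda w hw hl hnl).
Qed.
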